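(* Let $s\in(0,1)$, let $\Omega\subset\mathbb{R}^n$ be an open set and let $E_0\subset\mathbb{R}^n$. Then there exists a set $E\subset\mathbb{R}^n$ which is $s$-minimal in $\Omega$ and satisfies $E\setminus\Omega=E_0\setminus\Omega$ if and only if there exists a set $F\subset\mathbb{R}^n$ with $F\setminus\Omega=E_0\setminus\Omega$ and $P_s(F,\Omega)<\infty$.
   Context: All sets are Lebesgue measurable and are identified up to sets of measure zero. For disjoint $A,B\subset\mathbb{R}^n$ put $\mathcal{L}_s(A,B)=\int_A\int_B\frac{dx\,dy}{|x-y|^{n+s}}\in[0,\infty]$. The $s$-perimeter of $E\subset\mathbb{R}^n$ in an open set $\Omega\subset\mathbb{R}^n$ is, writing $E^c=\mathbb{R}^n\setminus E$, $$P_s(E,\Omega)=\mathcal{L}_s(E\cap\Omega,E^c\cap\Omega)+\mathcal{L}_s(E\cap\Omega,E^c\setminus\Omega)+\mathcal{L}_s(E\setminus\Omega,E^c\cap\Omega).$$ $E$ is $s$-minimal in $\Omega$ if $P_s(E,\Omega)<\infty$ and $P_s(E,\Omega)\leq P_s(F,\Omega)$ for every $F\subset\mathbb{R}^n$ with $F\setminus\Omega=E\setminus\Omega$. *)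

(* Defs.v *)
From HB Require Import structures.
From mathcomp Require Import all_boot all_order all_algebra.
From mathcomp Require Import all_classical all_reals all_analysis.

Set Implicit Arguments.
Unset Strict Implicit.
Unset Printing Implicit Defensive.

Import Order.TTheory GRing.Theory Num.Theory.
Import numFieldNormedType.Exports.

Local Open Scope classical_set_scope.
Local Open Scope ring_scope.

(* The space R^n with n >= 1 is 'rV[R]_m.+1 with n = m.+1.  Its library
   topology, for which [open] is used, is the product topology, hence the
   Euclidean one; its library norm is however the sup norm, so that the
   Euclidean norm has to be defined separately. *)
Definition eucl_norm (R : realType) (n : nat) (x : 'rV[R]_n) : R :=
  Num.sqrt (\sum_(i < n) x ord0 i ^+ 2).

Section lebesgue_outer.
Context (R : realType) (m : nat).
Local Notation Rn := 'rV[R]_m.+1.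

Definition box (I : Rn * Rn) : set Rn :=
  [set x | forall i, x ord0 i \in `[I.1 ord0 i, I.2 ord0 i[].

Definition box_vol (I : Rn * Rn) : R :=
  \prod_(i < m.+1) Num.max 0 (I.2 ord0 i - I.1 ord0 i).

Local Open Scope ereal_scope.

Definition box_cover (X : set Rn) : set (nat -> Rn * Rn) :=
  [set I | X `<=` \bigcup_k box (I k)].

(* Since the dimension m.+1 is positive, there are empty boxes of volume 0, so
   that sequences of boxes also account for finite covers. *)
Definition lebesgue_outer (X : set Rn) : \bar R :=
  ereal_inf [set \sum_(k <oo) (box_vol (I k))%:E | I in box_cover X].

Let box_vol_ge0 I : 0 <= (box_vol I)%:E.
Proof. by rewrite lee_fin prodr_ge0// => i _; rewrite le_max lexx. Qed.

Let lebesgue_outer_ge0 X : 0 <= lebesgue_outer X.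
Proof.
by apply: le_ereal_inf_tmp => _ [I _ <-]; apply: nneseries_ge0 => k _ _.
Qed.

Let lebesgue_outer0 : lebesgue_outer set0 = 0.
Proof.
apply/eqP; rewrite eq_le lebesgue_outer_ge0 andbT.
apply: ereal_inf_lbound; exists (fun=> (0%R, 0%R)); first exact: sub0set.
rewrite eseries0// => k _ _; congr (_%:E).
by rewrite /box_vol big_ord_recl/= subrr maxxx mul0r.
Qed.

Let le_lebesgue_outer : {homo lebesgue_outer : A B / A `<=` B >-> A <= B}.
Proof.
move=> A B AB; apply/ereal_inf_le_tmp => _ [I BI <-].
by exists I => //; exact: subset_trans BI.
Qed.

Let lebesgue_outer_sigma_subadditive : sigma_subadditive lebesgue_outer.
Proof.
move=> A; have [[i ioo]|] := pselect (exists i, lebesgue_outer (A i) = +oo).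
  rewrite (eseries_pinfty _ _ ioo) ?leey// => n _.
  by rewrite -ltNye (lt_le_trans _ (lebesgue_outer_ge0 _)).
rewrite -forallNE => Aoo.
apply/lee_addgt0Pr => _/posnumP[e].
rewrite (le_trans _ (epsilon_trick _ _ _))//.
have [G PG] : {G : nat -> nat -> Rn * Rn & forall n, box_cover (A n) (G n) /\
    \sum_(k <oo) (box_vol (G n k))%:E <=
      lebesgue_outer (A n) + (e%:num / (2 ^ n.+1)%:R)%:E}.
  apply: (@choice _ _ (fun n I => box_cover (A n) I /\
    \sum_(k <oo) (box_vol (I k))%:E <=
      lebesgue_outer (A n) + (e%:num / (2 ^ n.+1)%:R)%:E)) => n.
  have en1 : (0 < e%:num / (2 ^ n.+1)%:R)%R by [].
  have fin : lebesgue_outer (A n) \is a fin_num.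
    by rewrite ge0_fin_numE// ltey; exact/eqP/Aoo.
  have [_ [I AI <-] /ltW IA] := lb_ereal_inf_adherent en1 fin.
  by exists I.
pose v (p : nat * nat) := (box_vol (G p.1 p.2))%:E.
have /card_esym/ppcard_eqP[f] := card_nat2.
apply: (@le_trans _ _ (\esum_(p in [set: nat * nat]) v p)).
  apply: ereal_inf_lbound; exists (fun k => G (f k).1 (f k).2).
    move=> x [i _] /(PG i).1[j _ Gx].
    by exists (f^-1%FUN (i, j)) => //=; rewrite invK ?inE.
  rewrite nneseries_esumT; last by move=> k; exact: box_vol_ge0.
  rewrite [RHS](reindex_esum [set: nat] _ f)//.
rewrite (_ : \esum_(p in _) _ = \sum_(i <oo) \sum_(j <oo) v (i, j)).
  apply: lee_nneseries => [i _ _|i _]; last exact: (PG i).2.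
  by apply: nneseries_ge0 => j _ _; exact: box_vol_ge0.
rewrite nneseries_esumT; last first.
  by move=> k; apply: nneseries_ge0 => j _ _; exact: box_vol_ge0.
transitivity (\esum_(i in [set: nat]) \esum_(j in [set: nat]) v (i, j)).
  rewrite esum_esum; last by move=> *; exact: box_vol_ge0.
  by congr esum; apply/seteqP; split.
by apply: eq_esum => i _; rewrite nneseries_esumT// => j; exact: box_vol_ge0.
Qed.

HB.instance Definition _ := isOuterMeasure.Build R Rn lebesgue_outer
  lebesgue_outer0 lebesgue_outer_ge0 le_lebesgue_outer
  lebesgue_outer_sigma_subadditive.

End lebesgue_outer.

Section lebesgue_measure_Rn.
Context (R : realType) (m : nat).
Local Notation Rn := 'rV[R]_m.+1.
Local Notation outer := (@lebesgue_outer R m).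

Definition lebesgue_measurable (A : set Rn) : Prop :=
  outer.-cara.-measurable A.

Definition lebesgue : {measure set (caratheodory_type outer) -> \bar R} :=
  [the outer_measure _ _ of outer] : set (caratheodory_type outer) -> \bar R.

(* Equality of sets that are identified up to Lebesgue-null sets. *)
Definition eq_mod_null (A B : set Rn) : Prop :=
  \forall x \ae lebesgue, A x <-> B x.

End lebesgue_measure_Rn.

Section fractional_perimeter.
Context (R : realType) (m : nat) (s : R).
Local Notation Rn := 'rV[R]_m.+1.
Local Notation leb := (lebesgue R m).
Local Open Scope ereal_scope.

(* Only used for disjoint A and B: the value of the kernel on the diagonal is
   irrelevant. *)
Definition interaction (A B : set Rn) : \bar R :=
  \int[leb]_(x in A) \int[leb]_(y in B)
    ((eucl_norm (x - y : Rn) `^ (m.+1%:R + s))^-1)%:E.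

Definition s_perimeter (E W : set Rn) : \bar R :=
  interaction (E `&` W) (~` E `&` W)
  + interaction (E `&` W) (~` E `\` W)
  + interaction (E `\` W) (~` E `&` W).

Definition s_minimal (E W : set Rn) : Prop :=
  [/\ lebesgue_measurable E,
      s_perimeter E W < +oo &
      forall F : set Rn, lebesgue_measurable F ->
        eq_mod_null (F `\` W) (E `\` W) ->
        s_perimeter E W <= s_perimeter F W].

End fractional_perimeter.

(* Main.v *)
(* The perimeter is submodular: P(E u F) + P(E n F) <= P(E) + P(F).  Let i be
   the infimum of P over the competitors and let P(E_k) <= i + 2^-(k+1).  Since
   intersections of competitors are competitors, submodularity gives
   P(E_k u ... u E_(k+n)) <= i + 2^-k by induction on n.  Continuity of the
   interaction along monotone sequences of sets then yields first
   P(U_(j >= k) E_j) <= i + 2^-k and then P(limsup E_k) <= i, without any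
   compactness argument.  Fubini's theorem is not needed either: the inner
   integral of the interaction is lower semicontinuous in x by Fatou's lemma,
   hence measurable. *)
Require Import Defs.
From mathcomp Require Import all_boot all_order all_algebra.
From mathcomp Require Import all_classical all_reals all_analysis.
From mathcomp Require Import measurable_realfun lra.

Set Implicit Arguments.
Unset Strict Implicit.
Unset Printing Implicit Defensive.

Import Order.TTheory GRing.Theory Num.Theory.
Import numFieldNormedType.Exports.
Local Open Scope classical_set_scope.
Local Open Scope ring_scope.

(** * Carathéodory measurability of half-spaces, boxes and open sets *)

Section lebesgue_measurable_open.
Context (R : realType) (m : nat).
Local Notation Rn := 'rV[R]_m.+1.
Local Notation outer := (@lebesgue_outer R m).

Let set_coord (x : Rn) (i : 'I_m.+1) (c : R) : Rn :=
  \row_j (if j == i then c else x ord0 j).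

Lemma box_vol_set_coord (a b a' b' : Rn) (i : 'I_m.+1) :
  (forall j, j != i -> a' ord0 j = a ord0 j /\ b' ord0 j = b ord0 j) ->
  box_vol (a', b') = Num.max 0 (b' ord0 i - a' ord0 i) *
    \prod_(j < m.+1 | j != i) Num.max 0 (b ord0 j - a ord0 j).
Proof.
move=> ab; rewrite /box_vol (bigD1 i)//=; congr (_ * _).
by apply: eq_bigr => j /ab[-> ->].
Qed.

(** The hyperplane [x_i = c] cuts the box in two. Clamping [c] by [min] and [max] covers the case
    where it misses the box: one piece then has volume 0. *)
Lemma box_vol_split (a b : Rn) (i : 'I_m.+1) (c : R) :
  box_vol (a, set_coord b i (Num.min (b ord0 i) c)) +
  box_vol (set_coord a i (Num.max (a ord0 i) c), b) = box_vol (a, b).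
Proof.
rewrite (@box_vol_set_coord a b a b i)//.
rewrite (@box_vol_set_coord a b a _ i); last first.
  by move=> j /negbTE ji; rewrite mxE ji.
rewrite (@box_vol_set_coord a b _ b i); last first.
  by move=> j /negbTE ji; rewrite mxE ji.
rewrite -mulrDl !mxE eqxx; congr (_ * _).
(* Only the [i]-th side differs, which leaves an identity between truncated lengths in [l], [h] and
   [c]. *)
move: (a ord0 i) (b ord0 i) => l h.
by case: (leP h c) => ?; case: (leP l c) => ?; case: (leP 0 (h - l)) => ?;
  case: (leP 0 (c - l)) => ?; case: (leP 0 (h - c)) => ?; lra.
Qed.

(** Cutting each box of a cover of [X] along the hyperplane gives covers of the two parts of [X]
    with the same total volume, which is Carathéodory's criterion. *)
Lemma lebesgue_measurable_halfspace (i : 'I_m.+1) (c : R) :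
  lebesgue_measurable [set x : Rn | x ord0 i < c].
Proof.
apply: le_caratheodory_measurable => X.
apply: le_ereal_inf_tmp => _ [I XI <-].
pose I1 k := ((I k).1, set_coord (I k).2 i (Num.min ((I k).2 ord0 i) c)).
pose I2 k := (set_coord (I k).1 i (Num.max ((I k).1 ord0 i) c), (I k).2).
have vol0 J : (0 <= (@box_vol R m J)%:E)%E.
  by rewrite lee_fin prodr_ge0// => j _; rewrite le_max lexx.
have -> : (\sum_(k <oo) (box_vol (I k))%:E =
    \sum_(k <oo) (box_vol (I1 k))%:E + \sum_(k <oo) (box_vol (I2 k))%:E)%E.
  rewrite -nneseriesD//.
  apply: eq_eseriesr => k _.
  by rewrite -EFinD box_vol_split -surjective_pairing.
apply: leeD; apply: ereal_inf_lbound.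
- exists I1 => // x [/XI[k _ Ikx] /= xc]; exists k => // j.
  have := Ikx j; rewrite !in_itv/= mxE; case: eqP => [->|//] /andP[-> /=].
  by rewrite lt_min => ->.
- exists I2 => // x [/XI[k _ Ikx] /= /negP]; rewrite -leNgt => xc.
  exists k => // j.
  have := Ikx j; rewrite !in_itv/= mxE; case: eqP => [->|//] /andP[+ ->].
  by rewrite ge_max xc andbT => ->.
Qed.

Lemma lebesgue_measurable_box (I : Rn * Rn) : lebesgue_measurable (box I).
Proof.
have -> : box I = \bigcap_(i in [set: 'I_m.+1])
    ([set x : Rn | x ord0 i < I.2 ord0 i] `\`
     [set x : Rn | x ord0 i < I.1 ord0 i]).
  apply/seteqP; split => x Ix i.
    move=> _; have := Ix i; rewrite in_itv/= => /andP[le1 lt2].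
    by split => //=; apply/negP; rewrite -leNgt.
  by have [/= lt2 /negP] := Ix i Logic.I; rewrite -leNgt in_itv/= lt2 andbT.
apply: (@fin_bigcap_measurable _ (caratheodory_type outer)) => // i _.
by apply: (@measurableD _ (caratheodory_type outer));
  exact: lebesgue_measurable_halfspace.
Qed.

(** Each point of [U] lies in a box with rational corners contained in [U], and there are countably
    many such boxes. *)
Lemma open_lebesgue_measurable (U : set Rn) : open U -> lebesgue_measurable U.
Proof.
move=> oU.
pose B (p : 'rV[rat]_m.+1 * 'rV[rat]_m.+1) : set Rn :=
  box (map_mx ratr p.1, map_mx ratr p.2).
(* Boxes that leave [U] are replaced by [set0], so that the union runs over a whole countable
   type. *)
have -> : U = \bigcup_p (if `[< B p `<=` U >] then B p else set0).
  apply/seteqP; split => [x Ux|x [p _]]; last first.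
    by case: ifPn => // /asboolP BU /BU.
  have /nbhs_ballP[e /= e0 xeU] : nbhs x U by exact: open_nbhs_nbhs.
  have /choice[a aP] (i : 'I_m.+1) :
      exists q : rat, x ord0 i - e < ratr q < x ord0 i.
    have [|q] := @rat_in_itvoo R (x ord0 i - e) (x ord0 i); first by lra.
    by rewrite in_itv/=; exists q.
  have /choice[b bP] (i : 'I_m.+1) :
      exists q : rat, x ord0 i < ratr q < x ord0 i + e.
    have [|q] := @rat_in_itvoo R (x ord0 i) (x ord0 i + e); first by lra.
    by rewrite in_itv/=; exists q.
  exists (\row_i a i, \row_i b i) => //.
  (* Balls are those of the sup norm, so a box whose sides stay within [e] of [x] lies in the
     ball. *)
  rewrite ifT; last first.
    apply/asboolP => y By; apply: xeU; split => // i j; rewrite ord1.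
    have := By j; have := aP j; have := bP j; rewrite in_itv/= !mxE.
    by rewrite /ball/= ltr_distlC => /andP[? ?] /andP[? ?] /andP[? ?]; lra.
  move=> i; rewrite in_itv/= !mxE.
  by have /andP[_ /ltW ->] := aP i; have /andP[-> _] := bP i.
apply: (@countable_bigcupT_measurable _ (caratheodory_type outer)) => [//|p].
case: ifP => _; first exact: lebesgue_measurable_box.
exact: (@measurable0 _ (caratheodory_type outer)).
Qed.

End lebesgue_measurable_open.

(** * Lower semicontinuity along sequences, and the Euclidean norm *)

Lemma lower_semicontinuous_seq (R : realType) (T : pseudoMetricType R)
    (f : T -> \bar R) :
  (forall (x : T) (u : nat -> T), u @ \oo --> x ->
    (f x <= limn_einf (f \o u))%E) -> lower_semicontinuous f.
Proof.
move=> fP x a afx; apply: contrapT => nV.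
(* If semicontinuity fails at [x], points with value at most [a] exist in arbitrarily small balls;
   they form a sequence tending to [x] whose liminf is at most [a < f x]. *)
have /choice[u uP] (n : nat) : exists y, ball x n.+1%:R^-1 y /\ (f y <= a%:E)%E.
  apply: contrapT => ny; apply: nV; exists (ball x n.+1%:R^-1).
    by apply: nbhsx_ballx; rewrite invr_gt0.
  by move=> y xy; rewrite ltNge; apply/negP => fya; apply: ny; exists y.
have ux : u @ \oo --> x.
  apply/cvg_ballP => e e0; near=> n.
  apply: le_ball (uP n).1; apply: ltW.
  by near: n; exact: near_infty_natSinv_lt (PosNum e0).
have := lt_le_trans afx (fP x u ux); apply/negP; rewrite -leNgt.
rewrite limn_einf_lim; apply: lime_le; first exact: is_cvg_einfs.
apply: nearW => n; apply: le_trans (uP n).2.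
by apply: ereal_inf_lbound; exists n => /=.
Unshelve. all: by end_near. Qed.

Lemma limn_einf_ge0 (R : realType) (u : (\bar R)^nat) :
  (forall n, 0 <= u n)%E -> (0 <= limn_einf u)%E.
Proof.
move=> u0; rewrite limn_einf_lim; apply: lime_ge; first exact: is_cvg_einfs.
by apply: nearW => n; apply: le_ereal_inf_tmp => _ [k _ <-].
Qed.

Lemma continuous_eucl_norm (R : realType) (n : nat) :
  continuous (@eucl_norm R n).
Proof.
move=> x; apply: continuous_comp; last exact: sqrt_continuous.
apply: continuous_big => [|i _ y]; first exact: add_continuous.
apply: (@continuous_comp _ _ _ (fun M : 'rV[R]_n => M ord0 i)
  (fun r => r ^+ 2)); [exact: coord_continuous|exact: exprn_continuous].
Qed.

Lemma eucl_norm_gt0 (R : realType) (n : nat) (x : 'rV[R]_n) :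
  x != 0 -> 0 < eucl_norm x.
Proof.
move=> /rV0Pn[i xi0]; rewrite sqrtr_gt0 (bigD1 i)//=.
by rewrite ltr_wpDr ?sumr_ge0// => [j _|]; rewrite ?sqr_ge0// exprn_even_gt0.
Qed.

(** * The fractional kernel and the measurability of its potentials *)

Section potential.
Context (R : realType) (m : nat) (s : R).
Hypothesis s0 : 0 < s.
Local Notation Rn := 'rV[R]_m.+1.
Local Notation Tn := (caratheodory_type (@lebesgue_outer R m)).
Local Notation leb := (lebesgue R m).

Definition frac_kernel (z : Rn) : R := (eucl_norm z `^ (m.+1%:R + s))^-1.

(** This is the inner integral of [interaction], isolated as a function of the outer variable. *)
Definition potential (B : set Rn) (x : Rn) : \bar R :=
  \int[leb]_(y in B) (frac_kernel (x - y))%:E.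

Lemma frac_kernel_ge0 (z : Rn) : 0 <= frac_kernel z.
Proof. by rewrite invr_ge0 powR_ge0. Qed.

(* At the origin the junk value 0^-1 = 0 is what makes the kernel lower
   semicontinuous there. *)
Lemma frac_kernel_lsc (x : Rn) (u : nat -> Rn) : u @ \oo --> x ->
  ((frac_kernel x)%:E <= limn_einf (fun n => (frac_kernel (u n))%:E))%E.
Proof.
move=> ux; have [->|x0] := eqVneq x 0.
  rewrite {1}/frac_kernel /eucl_norm big1 => [|i _]; last by rewrite mxE expr0n.
  rewrite sqrtr0 powR0 ?invr0.
    by apply: limn_einf_ge0 => n; rewrite lee_fin frac_kernel_ge0.
  by rewrite gt_eqF// ltr_wpDl.
have kx : (frac_kernel (u n))%:E @[n --> \oo] --> (frac_kernel x)%:E.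
  apply: cvg_EFin; first exact: nearW.
  apply: (@cvg_comp _ _ _ u frac_kernel) ux _.
  apply: cvgV; first by rewrite gt_eqF// powR_gt0// eucl_norm_gt0.
  apply: (@continuous_comp _ _ _ (@eucl_norm R m.+1)
    (fun r => r `^ (m.+1%:R + s))); first exact: continuous_eucl_norm.
  apply/differentiable_continuous/derivable1_diffP.
  by apply: derivable_powR; rewrite in_itv/= andbT eucl_norm_gt0.
have ckx : cvgn (fun n => (frac_kernel (u n))%:E) by apply: cvgP kx.
by rewrite (is_cvg_limn_einfE ckx) (cvg_lim _ kx).
Qed.

(** Superlevel sets are open, and the rays []a, +oo]] generate the measurable sets of the extended
    reals. *)
Lemma lower_semicontinuous_lebesgue_measurable (f : Tn -> \bar R) :
  lower_semicontinuous (f : Rn -> \bar R) -> measurable_fun [set: Tn] f.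
Proof.
move=> lf; apply: (measurability _ (ErealGenOInfty.measurableE R)).
move=> /= _ [_ [a ->]] <-; apply: measurableI => //.
apply: open_lebesgue_measurable.
by rewrite preimage_itvoy; move/lower_semicontinuousP : lf; exact.
Qed.

Lemma measurable_frac_kernel (x : Rn) :
  measurable_fun [set: Tn] (fun y : Tn => (frac_kernel (x - (y : Rn)))%:E).
Proof.
apply: lower_semicontinuous_lebesgue_measurable.
apply: lower_semicontinuous_seq => y u uy.
by apply: frac_kernel_lsc; apply: cvgB => //; exact: cvg_cst.
Qed.

Lemma potential_ge0 (B : set Tn) (x : Rn) : (0 <= potential B x)%E.
Proof. by apply: integral_ge0 => y _; rewrite lee_fin frac_kernel_ge0. Qed.

Lemma measurable_potential (B : set Tn) : measurable B ->
  measurable_fun [set: Tn] (potential B : Tn -> \bar R).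
Proof.
move=> mB; apply: lower_semicontinuous_lebesgue_measurable.
apply: lower_semicontinuous_seq => x u ux.
have mk (z : Rn) :
    measurable_fun B (fun y : Tn => (frac_kernel (z - (y : Rn)))%:E).
  by apply: measurable_funTS; exact: measurable_frac_kernel.
(* Fatou's lemma reduces the claim to the pointwise semicontinuity of the kernel. *)
apply: le_trans (fatou leb mB (fun n => mk (u n)) _); last first.
  by move=> n y _; rewrite lee_fin frac_kernel_ge0.
apply: ge0_le_integral.
- exact: mB.
- by move=> y _; rewrite lee_fin frac_kernel_ge0.
- exact: mk.
(* The liminf is the pointwise limit of the tail infima, each of which is measurable. *)
- under eq_fun do rewrite limn_einf_lim.
  apply: (emeasurable_fun_cvg (fun n (y : Tn) =>
    einfs (fun k => (frac_kernel (u k - (y : Rn)))%:E) n)) => [n|y _].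
    by apply: measurable_fun_einfs => k; exact: mk.
  exact: is_cvg_einfs.
- move=> y _; apply: frac_kernel_lsc.
  by apply: cvgB => //; exact: cvg_cst.
Qed.

End potential.

(** * Additivity, monotonicity and monotone continuity of the interaction *)

Section interaction_theory.
Context (R : realType) (m : nat) (s : R).
Hypothesis s0 : 0 < s.
Local Notation Rn := 'rV[R]_m.+1.
Local Notation Tn := (caratheodory_type (@lebesgue_outer R m)).
Local Notation leb := (lebesgue R m).
Local Notation L := (@interaction R m s).
Local Notation k := (@frac_kernel R m s).
Local Notation g := (@potential R m s).
Local Open Scope ereal_scope.

Let mg (A B : set Tn) : measurable B -> measurable_fun A (g B : Tn -> \bar R).
Proof. by move=> mB; apply: measurable_funTS; exact: measurable_potential. Qed.

Let mk (A : set Tn) (x : Rn) :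
  measurable_fun A (fun y : Tn => (k (x - (y : Rn)))%:E).
Proof. by apply: measurable_funTS; exact: measurable_frac_kernel. Qed.

Let k0 (x y : Rn) : 0 <= (k (x - y))%:E.
Proof. by rewrite lee_fin frac_kernel_ge0. Qed.

Lemma interactionE (A B : set Tn) : L A B = \int[leb]_(x in A) g B x.
Proof. by []. Qed.

Lemma interaction_ge0 (A B : set Tn) : 0 <= L A B.
Proof. by apply: integral_ge0 => x _; exact: potential_ge0. Qed.

Lemma potentialU (B C : set Tn) (x : Rn) : measurable B -> measurable C ->
  [disjoint B & C] -> g (B `|` C) x = g B x + g C x.
Proof. by move=> mB mC BC; rewrite [LHS]ge0_integral_setU. Qed.

Lemma le_potential (B C : set Tn) (x : Rn) : measurable B -> measurable C ->
  B `<=` C -> g B x <= g C x.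
Proof. by move=> mB mC BC; exact: ge0_subset_integral. Qed.

Lemma interactionUl (A A' B : set Tn) : measurable A -> measurable A' ->
  measurable B -> [disjoint A & A'] -> L (A `|` A') B = L A B + L A' B.
Proof.
move=> mA mA' mB AA'; rewrite !interactionE.
apply: ge0_integral_setU; [exact: mA|exact: mA'|exact: mg| |exact: AA'].
by move=> x _; exact: potential_ge0.
Qed.

Lemma interactionUr (A B B' : set Tn) : measurable A -> measurable B ->
  measurable B' -> [disjoint B & B'] -> L A (B `|` B') = L A B + L A B'.
Proof.
move=> mA mB mB' BB'; rewrite !interactionE -ge0_integralD; last first.
- exact: mg.
- by move=> x _; exact: potential_ge0.
- exact: mg.
- by move=> x _; exact: potential_ge0.
- exact: mA.
by apply: eq_integral => x _; exact: potentialU.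
Qed.

Lemma le_interaction (A A' B B' : set Tn) : measurable A -> measurable A' ->
  measurable B -> measurable B' -> A `<=` A' -> B `<=` B' -> L A B <= L A' B'.
Proof.
move=> mA mA' mB mB' AA' BB'; apply: (@le_trans _ _ (L A B')).
  rewrite !interactionE; apply: ge0_le_integral.
  - exact: mA.
  - by move=> x _; exact: potential_ge0.
  - exact: mg.
  - exact: mg.
  - by move=> x _; exact: le_potential.
rewrite !interactionE; apply: ge0_subset_integral.
- exact: mA.
- exact: mA'.
- exact: mg.
- by move=> x _; exact: potential_ge0.
- exact: AA'.
Qed.

Lemma interaction_bigcupl_cvg (A : (set Tn)^nat) (B : set Tn) :
  (forall n, measurable (A n)) -> measurable B ->
  {homo A : i j / (i <= j)%N >-> (i <= j)%O} ->
  L (A n) B @[n --> \oo] --> L (\bigcup_n A n) B.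
Proof.
move=> mA mB ndA; rewrite interactionE.
apply: ge0_nondecreasing_set_cvg_integral.
- exact: ndA.
- exact: mA.
- by move=> i; exact: mg.
- by move=> i x _; exact: potential_ge0.
Qed.

Lemma potential_bigcup_cvg (B : (set Tn)^nat) (x : Rn) :
  (forall n, measurable (B n)) ->
  {homo B : i j / (i <= j)%N >-> (i <= j)%O} ->
  g (B n) x @[n --> \oo] --> g (\bigcup_n B n) x.
Proof.
by move=> mB ndB; apply: ge0_nondecreasing_set_cvg_integral.
Qed.

(** Monotone convergence is used twice: the potentials of [B n] increase to that of the union, and
    then the outer integral follows. *)
Lemma interaction_bigcupr_cvg (A : set Tn) (B : (set Tn)^nat) :
  measurable A -> (forall n, measurable (B n)) ->
  {homo B : i j / (i <= j)%N >-> (i <= j)%O} ->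
  L A (B n) @[n --> \oo] --> L A (\bigcup_n B n).
Proof.
move=> mA mB ndB.
have -> : L A (\bigcup_n B n) = \int[leb]_(x in A) limn (fun n => g (B n) x).
  rewrite interactionE; apply: eq_integral => x _; apply/esym/cvg_lim => //.
  exact: potential_bigcup_cvg.
apply: cvg_monotone_convergence.
- exact: mA.
- by move=> n; exact: mg.
- by move=> n x _; exact: potential_ge0.
- move=> x _ i j ij; apply: le_potential => //.
  by apply/subsetPset; exact: ndB.
Qed.

End interaction_theory.

(** * Submodularity of the perimeter and its behaviour under monotone limits *)

Section s_perimeter_theory.
Context (R : realType) (m : nat) (s : R).
Hypothesis s0 : 0 < s.
Local Notation Tn := (caratheodory_type (@lebesgue_outer R m)).
Local Notation L := (@interaction R m s).
Local Notation P := (@s_perimeter R m s).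
Local Open Scope ereal_scope.

(** Once everything is split along [E] and [F], each interaction of pieces on the left also occurs
    on the right. Arbitrary [U] and [V] let one inequality serve all three terms of the
    perimeter. *)
Lemma interaction_submodular (U V E F : set Tn) : measurable U ->
  measurable V -> measurable E -> measurable F ->
  L ((E `|` F) `&` U) (~` (E `|` F) `&` V) +
  L ((E `&` F) `&` U) (~` (E `&` F) `&` V) <=
  L (E `&` U) (~` E `&` V) + L (F `&` U) (~` F `&` V).
Proof.
move=> mU mV mE mF.
(* Unprimed pieces lie in [U], primed ones in [V]. Note that [a] is the common part of [E] and [F],
   whereas [a'] is their common complement. *)
pose a : set Tn := (E `&` F `&` U); pose a' : set Tn := (~` E `&` ~` F `&` V).
pose b : set Tn := ((E `\` F) `&` U); pose b' : set Tn := ((E `\` F) `&` V).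
pose c : set Tn := ((F `\` E) `&` U); pose c' : set Tn := ((F `\` E) `&` V).
have ma : measurable a by do 2 apply: measurableI => //.
have mb : measurable b by apply: measurableI => //; exact: measurableD.
have mc : measurable c by apply: measurableI => //; exact: measurableD.
have ma' : measurable a'.
  by do 2 apply: measurableI => //; exact: measurableC.
have mb' : measurable b' by apply: measurableI => //; exact: measurableD.
have mc' : measurable c' by apply: measurableI => //; exact: measurableD.
have -> : (E `|` F) `&` U = a `|` (b `|` c).
  apply/seteqP; split=> x; rewrite /a /b /c/=; have := EM (E x);
    by have := EM (F x); tauto.
have -> : E `&` U = a `|` b.
  by apply/seteqP; split=> x; rewrite /a /b/=; have := EM (F x); tauto.
have -> : F `&` U = a `|` c.
  by apply/seteqP; split=> x; rewrite /a /c/=; have := EM (E x); tauto.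
have -> : ~` (E `|` F) `&` V = a'.
  by apply/seteqP; split=> x; rewrite /a'/=; tauto.
have -> : ~` (E `&` F) `&` V = a' `|` (b' `|` c').
  apply/seteqP; split=> x; rewrite /a' /b' /c'/=; have := EM (E x);
    by have := EM (F x); tauto.
have -> : ~` E `&` V = a' `|` c'.
  by apply/seteqP; split=> x; rewrite /a' /c'/=; have := EM (F x); tauto.
have -> : ~` F `&` V = a' `|` b'.
  by apply/seteqP; split=> x; rewrite /a' /b'/=; have := EM (E x); tauto.
have dis (A B : set Tn) : (forall x, A x -> B x -> False) -> [disjoint A & B].
  by move=> AB; apply/eqP; rewrite -subset0 => x [/AB].
have ab : [disjoint a & b] by apply: dis => x; rewrite /a /b/=; tauto.
have ac : [disjoint a & c] by apply: dis => x; rewrite /a /c/=; tauto.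
have bc : [disjoint b & c] by apply: dis => x; rewrite /b /c/=; tauto.
have abc : [disjoint a & b `|` c].
  by apply: dis => x; rewrite /a /b /c/=; tauto.
have ab' : [disjoint a' & b'] by apply: dis => x; rewrite /a' /b'/=; tauto.
have ac' : [disjoint a' & c'] by apply: dis => x; rewrite /a' /c'/=; tauto.
have bc' : [disjoint b' & c'] by apply: dis => x; rewrite /b' /c'/=; tauto.
have abc' : [disjoint a' & b' `|` c'].
  by apply: dis => x; rewrite /a' /b' /c'/=; tauto.
have mU2 (A B : set Tn) := @measurableU _ Tn A B.
rewrite (interactionUl s0 ma (mU2 _ _ mb mc) ma' abc).
rewrite (interactionUl s0 mb mc ma' bc).
rewrite (interactionUr s0 ma ma' (mU2 _ _ mb' mc') abc').
rewrite (interactionUr s0 ma mb' mc' bc').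
rewrite (interactionUl s0 ma mb (mU2 _ _ ma' mc') ab).
rewrite (interactionUl s0 ma mc (mU2 _ _ ma' mb') ac).
rewrite (interactionUr s0 ma ma' mc' ac') (interactionUr s0 mb ma' mc' ac').
rewrite (interactionUr s0 ma ma' mb' ab') (interactionUr s0 mc ma' mb' ab').
(* The excess of the right-hand side is L b c' + L c b'. *)
rewrite [leRHS](AC ((2*2)*(2*2)) ((1*(3*7))*(5*(6*2))*(4*8))).
by rewrite leeDl// adde_ge0//; exact: interaction_ge0.
Qed.

Context (W : set Tn) (mW : measurable W).

Let mWc : measurable (~` W). Proof. exact: measurableC. Qed.

Lemma s_perimeter_ge0 (E : set Tn) : 0 <= P E W.
Proof.
by apply: adde_ge0; [apply: adde_ge0|]; exact: interaction_ge0.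
Qed.

Lemma s_perimeter_submodular (E F : set Tn) : measurable E -> measurable F ->
  P (E `|` F) W + P (E `&` F) W <= P E W + P F W.
Proof.
move=> mE mF; rewrite /s_perimeter.
(* The terms are paired for the choices [(W, W)], [(W, ~] W)[and](~[W, W)] of [(U, V)]. *)
rewrite [leLHS](AC (3*3) ((1*4)*(2*5)*(3*6))).
rewrite [leRHS](AC (3*3) ((1*4)*(2*5)*(3*6))).
by apply: leeD; [apply: leeD|]; exact: interaction_submodular.
Qed.

(** Freezing the second argument at the complement of the full union only lowers the terms; the
    first argument alone then varies, and it increases to its limit. *)
Lemma s_perimeter_bigcup_le (F : (set Tn)^nat) (M : \bar R) :
  (forall n, measurable (F n)) ->
  {homo F : i j / (i <= j)%N >-> (i <= j)%O} ->
  (forall n, P (F n) W <= M) -> P (\bigcup_n F n) W <= M.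
Proof.
move=> mF ndF FM.
have mFT : measurable (\bigcup_n F n) by exact: bigcupT_measurable.
have cvgQ (U V : set Tn) : measurable U -> measurable V ->
    L (F n `&` U) (~` (\bigcup_n F n) `&` V) @[n --> \oo] -->
    L ((\bigcup_n F n) `&` U) (~` (\bigcup_n F n) `&` V).
  move=> mU mV; rewrite setI_bigcupl; apply: interaction_bigcupl_cvg => //.
  - by move=> n; exact: measurableI.
  - by apply: measurableI => //; exact: measurableC.
  - move=> i j ij; apply/subsetPset; apply: setSI.
    by apply/subsetPset; exact: ndF.
have leQ (U V : set Tn) n : measurable U -> measurable V ->
    L (F n `&` U) (~` (\bigcup_n F n) `&` V) <= L (F n `&` U) (~` F n `&` V).
  move=> mU mV; apply: le_interaction => //.
  - exact: measurableI.
  - exact: measurableI.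
  - by apply: measurableI => //; exact: measurableC.
  - by apply: measurableI => //; exact: measurableC.
  - by apply: setSI; apply: subsetC; exact: bigcup_sup.
have cvgL : L (F n `&` W) (~` (\bigcup_n F n) `&` W) +
    L (F n `&` W) (~` (\bigcup_n F n) `&` ~` W) +
    L (F n `&` ~` W) (~` (\bigcup_n F n) `&` W) @[n --> \oo] -->
    P (\bigcup_n F n) W.
  apply: cvgeD; last exact: cvgQ.
    rewrite ge0_adde_def// inE; last exact: interaction_ge0.
    by apply: adde_ge0; exact: interaction_ge0.
  apply: cvgeD; [|exact: cvgQ|exact: cvgQ].
  by rewrite ge0_adde_def// inE; exact: interaction_ge0.
apply: cvge_le cvgL; apply: nearW => n; apply: le_trans (FM n).
by apply: leeD; [apply: leeD|]; exact: leQ.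
Qed.

(** Dually, the first argument is frozen at the intersection while the complements increase. The
    bound varies with [n] because the tail unions have bounds that improve with their index. *)
Lemma s_perimeter_bigcap_le (F : (set Tn)^nat) (u : (\bar R)^nat) (l : \bar R) :
  (forall n, measurable (F n)) ->
  {homo F : i j / (i <= j)%N >-> (j <= i)%O} ->
  u @ \oo --> l ->
  (forall n, P (F n) W <= u n) -> P (\bigcap_n F n) W <= l.
Proof.
move=> mF niF ul FM.
have mFT : measurable (\bigcap_n F n) by exact: bigcapT_measurable.
have cvgQ (U V : set Tn) : measurable U -> measurable V ->
    L ((\bigcap_n F n) `&` U) (~` F n `&` V) @[n --> \oo] -->
    L ((\bigcap_n F n) `&` U) (~` (\bigcap_n F n) `&` V).
  move=> mU mV; rewrite setC_bigcap setI_bigcupl.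
  apply: interaction_bigcupr_cvg => //.
  - exact: measurableI.
  - by move=> n; apply: measurableI => //; exact: measurableC.
  - move=> i j ij; apply/subsetPset; apply: setSI; apply: subsetC.
    by apply/subsetPset; exact: niF.
have leQ (U V : set Tn) n : measurable U -> measurable V ->
    L ((\bigcap_n F n) `&` U) (~` F n `&` V) <= L (F n `&` U) (~` F n `&` V).
  move=> mU mV; apply: le_interaction => //.
  - exact: measurableI.
  - exact: measurableI.
  - by apply: measurableI => //; exact: measurableC.
  - by apply: measurableI => //; exact: measurableC.
  - by apply: setSI; exact: bigcap_inf.
have cvgL : L ((\bigcap_n F n) `&` W) (~` F n `&` W) +
    L ((\bigcap_n F n) `&` W) (~` F n `&` ~` W) +
    L ((\bigcap_n F n) `&` ~` W) (~` F n `&` W) @[n --> \oo] -->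
    P (\bigcap_n F n) W.
  apply: cvgeD; last exact: cvgQ.
    rewrite ge0_adde_def// inE; last exact: interaction_ge0.
    by apply: adde_ge0; exact: interaction_ge0.
  apply: cvgeD; [|exact: cvgQ|exact: cvgQ].
  by rewrite ge0_adde_def// inE; exact: interaction_ge0.
rewrite -(cvg_lim _ cvgL)// -(cvg_lim _ ul)//.
apply: lee_lim; [exact: cvgP cvgL|exact: cvgP ul|].
apply: nearW => n; apply: le_trans (FM n).
by apply: leeD; [apply: leeD|]; exact: leQ.
Qed.

End s_perimeter_theory.

(** Stated through the Carathéodory type, so that the filter structure can be handed to [filterS2]
    explicitly. *)
Lemma ae_lebesgue_filter (R : realType) (m : nat) :
  Filter (almost_everywhere (lebesgue R m)).
Proof.
exact: (@ae_filter_ringOfSetsType _ (caratheodory_type (@lebesgue_outer R m))).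
Qed.

(** * Stability of competitors under countable unions and intersections *)

Section competitors.
Context (R : realType) (m : nat) (W E0 : set 'rV[R]_m.+1).
Local Notation Tn := (caratheodory_type (@lebesgue_outer R m)).

Definition competitor (F : set 'rV[R]_m.+1) : Prop :=
  lebesgue_measurable F /\ eq_mod_null (F `\` W) (E0 `\` W).

(** The countably many exceptional null sets have a null union. An empty [D] would lose the part
    [E0] outside [W]. *)
Lemma competitor_bigcup (D : set nat) (F : (set Tn)^nat) : D !=set0 ->
  (forall n, competitor (F n)) -> competitor (\bigcup_(n in D) F n).
Proof.
move=> [n0 Dn0] FP; split.
  by apply: bigcup_measurable => n _; exact: (FP n).1.
have := ae_foralln (fun n => (FP n).2); apply: filterS => x Fx.
split=> [[[n Dn Fnx] Wx]|/(Fx n0)[Fx0 Wx]]; first exact/(Fx n).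
by split => //; exists n0.
Qed.

Lemma competitor_bigcap (F : (set Tn)^nat) :
  (forall n, competitor (F n)) -> competitor (\bigcap_n F n).
Proof.
move=> FP; split.
  by apply: bigcapT_measurable => n; exact: (FP n).1.
have := ae_foralln (fun n => (FP n).2); apply: filterS => x Fx.
split=> [[/(_ 0%N Logic.I) F0 Wx]|EWx]; first exact/(Fx 0%N).
by split=> [n _|]; [have [] := (Fx n).2 EWx|case: EWx].
Qed.

Lemma competitorI (F G : set Tn) :
  competitor F -> competitor G -> competitor (F `&` G).
Proof.
move=> [mF FE] [mG GE]; split; first exact: measurableI.
move: FE GE; apply: (@filterS2 _ _ (ae_lebesgue_filter R m)) => x FE GE.
split=> [[[Fx Gx] Wx]|EWx]; first exact/FE.
by split; [split; [have [] := FE.2 EWx|have [] := GE.2 EWx]|case: EWx].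
Qed.

End competitors.

(** * The limsup of a minimizing sequence *)

Section minimization.
Context (R : realType) (m : nat) (s : R).
Hypothesis s0 : 0 < s.
Local Notation Tn := (caratheodory_type (@lebesgue_outer R m)).
Context (W E0 : set Tn) (mW : measurable W).
Local Notation P F := (s_perimeter s F W).
Local Open Scope ereal_scope.

Context (r : R) (E : (set Tn)^nat).
Hypothesis r_le : forall F, competitor W E0 F -> r%:E <= P F.
Hypothesis E_comp : forall k, competitor W E0 (E k).
Hypothesis E_le : forall k, P (E k) <= (r + 2^-1 ^+ k.+1)%:E.

(** Both ends are included, so that [G k 0] is [E k] and the induction starts from a single set. *)
Let G k n : set Tn := \bigcup_(j in [set j | (k <= j <= k + n)%N]) E j.

Let G_comp k n : competitor W E0 (G k n).
Proof.
by apply: competitor_bigcup => //; exists k; rewrite /= leqnn leq_addr.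
Qed.

Let GS k n : G k n.+1 = G k n `|` E (k + n.+1)%N.
Proof.
apply/seteqP; split=> [x [j /= /andP[kj]]|x [[j /= /andP[kj jn] Ejx]|Enx]].
- rewrite leq_eqVlt => /predU1P[->|jn] Ejx; [by right|left].
  by exists j => //=; rewrite kj -ltnS -addnS.
- by exists j => //=; rewrite kj (leq_trans jn)// leq_add2l.
- by exists (k + n.+1)%N => //=; rewrite leq_addr leqnn.
Qed.

(* Intersections with the sets already chosen are competitors, so by
   submodularity each union costs at most the excess of the new set. *)
Let G_le k n : P (G k n) <= (r + 2^-1 ^+ k - 2^-1 ^+ (k + n).+1)%:E.
Proof.
elim: n => [|n IH].
  have -> : G k 0 = E k.
    apply/seteqP; split=> [x [j /=]|x Ex].
      by rewrite addn0 -eqn_leq => /eqP <-.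
    by exists k => //=; rewrite addn0 leqnn.
  apply: le_trans (E_le k) _; rewrite lee_fin addn0 exprS; lra.
have [mG _] := G_comp k n; have [mE _] := E_comp (k + n.+1)%N.
have := s_perimeter_submodular s0 mW mG mE; rewrite -GS => sub.
have rI := r_le (competitorI (G_comp k n) (E_comp (k + n.+1)%N)).
have {sub} := le_trans (leeD (lexx _) rI) (le_trans sub (leeD IH (E_le _))).
rewrite -leeBrDr// -EFinD => /le_trans; apply.
(* The excess of the new set is half of the term subtracted in [IH], so the subtracted term is
   halved and the bound stays below [r + 2^-1 ^+ k]. *)
by rewrite lee_fin addnS (exprS _ (k + n).+1); lra.
Qed.

Let F k : set Tn := \bigcup_n G k n.

Let F_comp k : competitor W E0 (F k).
Proof. by apply: competitor_bigcup => //; exists 0%N. Qed.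

Let F_le k : P (F k) <= (r + 2^-1 ^+ k)%:E.
Proof.
apply: s_perimeter_bigcup_le => //.
- by move=> n; exact: (G_comp k n).1.
- move=> i j ij; apply/subsetPset => x [l /= /andP[kl li] Elx].
  by exists l => //=; rewrite kl (leq_trans li)// leq_add2l.
- by move=> n; apply: le_trans (G_le k n) _; rewrite lee_fin gerBl exprn_ge0.
Qed.

Lemma limsup_minimizing_sequence : exists2 F, competitor W E0 F & P F <= r%:E.
Proof.
(* The intersection of the tail unions is the limsup of [E]. *)
exists (\bigcap_k F k); first exact: competitor_bigcap.
apply: (@s_perimeter_bigcap_le _ _ _ s0 _ mW _
  (fun k => (r + 2^-1 ^+ k)%:E)) => //.
- by move=> k; exact: (F_comp k).1.
- move=> i j ij; apply/subsetPset => x [n _ [l /= /andP[jl lj] Elx]].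
  (* With this choice [l] is the last index of the union [G i (l - i)]. *)
  exists (l - i)%N => //; exists l => //=.
  by rewrite subnKC ?(leq_trans ij)//= leqnn.
- apply: cvg_EFin; first exact: nearW.
  rewrite -[X in _ --> X]addr0; apply: cvgD; first exact: cvg_cst.
  by apply: cvg_expr; rewrite gtr0_norm ?invf_lt1// ltr1n.
Qed.

End minimization.

Theorem theorem1p8 (R : realType) (m : nat) (s : R) (hs : 0 < s < 1)
    (Omega : set 'rV[R]_m.+1) (hOmega : open Omega)
    (E0 : set 'rV[R]_m.+1) (hE0 : lebesgue_measurable E0) :
  (exists E : set 'rV[R]_m.+1,
      s_minimal s E Omega /\ eq_mod_null (E `\` Omega) (E0 `\` Omega)) <->
  (exists F : set 'rV[R]_m.+1,
      [/\ lebesgue_measurable F,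
          eq_mod_null (F `\` Omega) (E0 `\` Omega) &
          (s_perimeter s F Omega < +oo)%E]).
Proof.
split=> [[E [[mE PE _] EE0]]|[F0 [mF0 F0E0 PF0]]]; first by exists E.
have /andP[s0 _] := hs.
have mO := open_lebesgue_measurable hOmega.
pose S := [set s_perimeter s F Omega | F in competitor Omega E0].
have S0 : (0 <= ereal_inf S)%E.
  by apply: le_ereal_inf_tmp => _ [F _ <-]; exact: s_perimeter_ge0.
(* The competitor of finite perimeter enters here: a finite infimum can be approached within
   [2^-1 ^+ k.+1]. *)
have Sfin : ereal_inf S \is a fin_num.
  by rewrite ge0_fin_numE//; apply: le_lt_trans PF0;
    apply: ereal_inf_lbound; exists F0.
pose r := fine (ereal_inf S).
have rE : ereal_inf S = r%:E by rewrite fineK.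
have /choice[E EP] (k : nat) : exists F, competitor Omega E0 F /\
    (s_perimeter s F Omega <= (r + 2^-1 ^+ k.+1)%:E)%E.
  have h0 : 0 < 2^-1 ^+ k.+1 :> R by rewrite exprn_gt0.
  have [_ [F FE0 <-] /ltW] := lb_ereal_inf_adherent h0 Sfin.
  by rewrite rE; exists F.
have r_le F : competitor Omega E0 F -> (r%:E <= s_perimeter s F Omega)%E.
  by move=> FE0; rewrite -rE; apply: ereal_inf_lbound; exists F.
have [F [mF FE0] PF] := limsup_minimizing_sequence s0 mO r_le
  (fun k => (EP k).1) (fun k => (EP k).2).
exists F; split; last exact: FE0.
split; [exact: mF|exact: le_lt_trans PF (ltry _)|].
(* A set agreeing with [F] outside [Omega] also agrees with [E0] there, up to null sets, so its
   perimeter is at least [r]. *)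
move=> F' mF' F'F; apply: (le_trans PF); apply: r_le; split => //.
by move: F'F FE0; apply: (@filterS2 _ _ (ae_lebesgue_filter R m)) => x -> ->.
Qed.
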